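(* Let $Y$ be a real vector space and suppose that $A$ is a nonempty proper subset of $Y$. The following conditions are equivalent to each other for $A$ and $k\in Y\setminus\{0\}$: (a) $k\in-0^+A$. (b) $A=H-C$ for some proper subset $H$ of $Y$ and some convex cone $C\subset Y$ with $k\in C$. (c) $A=A-C$ for some non-trivial convex cone $C\subset Y$ with $k\in C$. (d) $A=A-C$ for some non-trivial cone $C\subset Y$ with $k\in C$.
   Context: The recession cone of $A$ is $0^+A:=\{u\in Y\mid\forall a\in A\ \forall t\in[0,\infty):\ a+tu\in A\}$. A set $C\subseteq Y$ is a cone iff $\lambda c\in C$ for all $\lambda\in[0,\infty)$, $c\in C$; it is non-trivial iff $C\ne\emptyset$, $C\ne\{0\}$ and $C\ne Y$. $H-C=\{h-c\mid h\in H,\ c\in C\}$. *)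

(* Defs.v *)
From HB Require Import structures.
From mathcomp Require Import all_boot all_order all_algebra.
From mathcomp Require Import classical_sets reals convex.

Set Implicit Arguments.
Unset Strict Implicit.
Unset Printing Implicit Defensive.

Import Order.TTheory GRing.Theory Num.Theory.

Local Open Scope classical_set_scope.
Local Open Scope ring_scope.

Section RecessionCone.
Variables (R : realType) (Y : lmodType R).
Implicit Types A H C : set Y.

Definition recession_cone A : set Y :=
  [set u | forall a, A a -> forall t : R, 0 <= t -> A (a + t *: u)].

Definition set_opp A : set Y := [set - u | u in A].

(* Elementwise difference {h - c}, not the set-theoretic one. *)
Definition set_sub H C : set Y := [set h - c | h in H & c in C].

(* The empty set is a cone; every nonempty cone contains 0. *)
Definition is_cone C : Prop :=
  forall (l : R) c, 0 <= l -> C c -> C (l *: c).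

Definition nontrivial_cone C : Prop :=
  [/\ is_cone C, C !=set0, C <> [set 0] & C <> setT].

Definition convex_cone C : Prop := is_cone C /\ convex_set C.

Definition proper_set A : Prop := A <> setT.

End RecessionCone.

(* Main.v *)
Require Import Defs.
From HB Require Import structures.
From mathcomp Require Import all_boot all_order all_algebra.
From mathcomp Require Import classical_sets reals convex.
From mathcomp Require Import interval_inference.

Import Order.TTheory GRing.Theory Num.Theory.

(** All four conditions say that subtracting nonnegative multiples of [k] does
    not lead out of [A].

    For (a) this is the definition; it amounts to [A = A - C] for the ray [C]
    spanned by [k] ([set_sub_ray]), which is (b) with [H = A].

    In (b) the set [H] can be replaced by [A] itself, because a convex cone
    satisfies [C + C = C], whence [A - C = H - (C + C) = H - C = A]
    ([set_sub_convex_cone_id]).  The cone is then automatically non-trivial: it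
    contains [k <> 0], and [C = Y] would make [H - C] the whole space, against
    the properness of [A].  This gives (c), of which (d) is a weakening.

    Finally, if [A = A - C] for a cone [C] containing [k], then every [t *: k]
    with [0 <= t] is in [C], so [a - t *: k] stays in [A], which is (a)
    ([cone_sub_opp_recession]). *)

Local Open Scope classical_set_scope.
Local Open Scope ring_scope.

Section ConesAndDifferences.
Context {R : realType} {Y : lmodType R}.
Implicit Types (A H C : set Y) (k : Y).

Definition ray k : set Y := [set t *: k | t in [set t : R | 0 <= t]].

Lemma mem_ray k : ray k k.
Proof. by exists 1; rewrite ?scale1r //= ler01. Qed.

Lemma convex_cone_ray k : convex_cone (ray k).
Proof.
split=> [l _ l_ge0 [t t_ge0 <-]|x y l].
  by exists (l * t); rewrite ?scalerA //= mulr_ge0.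
rewrite !inE => -[s s_ge0 <-] [t t_ge0 <-].
exists (l%:num * s + (1 - l%:num) * t); last by rewrite scalerDl -!scalerA.
by rewrite /= addr_ge0 // mulr_ge0 // subr_ge0 le1.
Qed.

Lemma cone0 C : is_cone C -> C !=set0 -> C 0.
Proof. by move=> coneC [c Cc]; rewrite -(scale0r c); apply: coneC. Qed.

(** The sum is twice the midpoint: convexity provides the midpoint, the cone
    property the factor. *)
Lemma convex_coneD C x y : convex_cone C -> C x -> C y -> C (x + y).
Proof.
move=> [coneC convC] Cx Cy.
have half01 : 0 <= 2^-1 :> R /\ 2^-1 <= 1 :> R.
  by rewrite invr_ge0 ler0n invf_le1 ?ltr0n // ler1n.
have := convC x y (Itv01 half01.1 half01.2) (mem_set Cx) (mem_set Cy).
rewrite inE => /(coneC 2 _ (ler0n _ 2)).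
suff -> : 2 *: (2^-1 *: x + (1 - 2^-1) *: y) = x + y by [].
have -> : 1 - 2^-1 = 2^-1 :> R by rewrite [X in X - _](splitr 1) mul1r addrK.
by rewrite -scalerDr scalerA divff ?pnatr_eq0 // scale1r.
Qed.

(** Two successive subtractions from [C] merge into one because [C + C] is
    contained in [C], and [0] in [C] gives the other inclusion. *)
Lemma set_sub_convex_cone_id H C : convex_cone C -> C !=set0 ->
  set_sub (set_sub H C) C = set_sub H C.
Proof.
move=> ccC C_neq0; apply/seteqP; split=> [_ [_ [h Hh [c Cc <-]] [d Cd <-]]|x Hx].
  by exists h => //; exists (c + d); [exact: convex_coneD | rewrite opprD addrA].
by exists x => //; exists 0; [exact: cone0 ccC.1 C_neq0 | rewrite subr0].
Qed.

Lemma set_subT H : H !=set0 -> set_sub H setT = setT.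
Proof.
move=> [h Hh]; apply/seteqP; split=> // x _.
by exists h => //; exists (h - x); rewrite ?subKr.
Qed.

Lemma set_sub_ray A k : set_opp (recession_cone A) k -> A = set_sub A (ray k).
Proof.
move=> [u rec_u <-]; apply/seteqP; split=> [a Aa|_ [a Aa [_ [t t_ge0 <-] <-]]].
  by exists a => //; exists 0; [exists 0; rewrite ?scale0r /= | rewrite subr0].
by rewrite scalerN opprK; apply: rec_u.
Qed.

Lemma cone_sub_opp_recession A C :
  is_cone C -> A = set_sub A C -> C `<=` set_opp (recession_cone A).
Proof.
move=> coneC eqA k Ck; exists (- k); last exact: opprK.
move=> a Aa t t_ge0; rewrite eqA.
by exists a => //; exists (t *: k); [exact: coneC | rewrite scalerN].
Qed.

End ConesAndDifferences.

Theorem proposition2 (R : realType) (Y : lmodType R) (A : set Y)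
    (A_nonempty : A !=set0) (A_proper : proper_set A)
    (k : Y) (k_neq0 : k <> 0) :
  [<-> (* a *) set_opp (recession_cone A) k;
       (* b *) exists H C : set Y,
         [/\ proper_set H, convex_cone C, C k & A = set_sub H C];
       (* c *) exists C : set Y,
         [/\ nontrivial_cone C, convex_set C, C k & A = set_sub A C];
       (* d *) exists C : set Y,
         [/\ nontrivial_cone C, C k & A = set_sub A C]].
Proof.
tfae.
- move=> rec_k; exists A, (ray k).
  by split=> //; [exact: convex_cone_ray | exact: mem_ray | exact: set_sub_ray].
- move=> [H [C [_ ccC Ck eqA]]].
  have C_neq0 : C !=set0 by exists k.
  exists C; split=> //; [|exact: ccC.2|by rewrite {2}eqA set_sub_convex_cone_id].
  split=> //; first exact: ccC.1.
    by move=> C0; apply: k_neq0; rewrite C0 in Ck.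
  move=> CT; apply: A_proper; rewrite eqA CT; apply: set_subT.
  by case: A_nonempty => a; rewrite eqA => -[h Hh _]; exists h.
- by move=> [C [ntC _ Ck eqA]]; exists C.
- by move=> [C [[coneC _ _ _] Ck eqA]]; apply: cone_sub_opp_recession Ck.
Qed.
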